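(* If $G$ is a graph of maximum degree $3$, then $\mathrm{diam}(\mathcal{I}(G)) \le 3$.
   Context: Graphs are finite and simple. An orientation of $G$ assigns a direction to each edge of $G$. Given an orientation $\overrightarrow{G_1}$ of $G$ and a subset $X\subseteq V(G)$, the inversion of $X$ on $\overrightarrow{G_1}$ is the operation that reverses the direction of all arcs with both end-vertices in $X$, which results in another orientation of $G$. The inversion graph $\mathcal{I}(G)$ is the graph whose vertices are the orientations of $G$, two orientations $\overrightarrow{G_1},\overrightarrow{G_2}$ being adjacent if and only if there is an inversion of some $X\subseteq V(G)$ transforming $\overrightarrow{G_1}$ into $\overrightarrow{G_2}$. The inversion diameter of $G$ is the diameter $\mathrm{diam}(\mathcal{I}(G))$ of this graph, i.e. the maximum, over pairs of orientations of $G$, of the minimum number of inversions needed to transform one into the other. *)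

(* Defs.v *)
From HB Require Import structures.
From mathcomp Require Import all_boot.

Set Implicit Arguments.
Unset Strict Implicit.
Unset Printing Implicit Defensive.

Record sgraph (V : finType) := SGraph {
  adj :> rel V;
  adj_sym : symmetric adj;
  adj_irrefl : irreflexive adj
}.

Definition degree (V : finType) (G : sgraph V) (x : V) : nat :=
  #|[set y | G x y]|.

Definition max_degree (V : finType) (G : sgraph V) : nat :=
  \max_(x : V) degree G x.

Definition has_walk (V : finType) (G : sgraph V) (k : nat) (x y : V) : bool :=
  [exists p : k.-tuple V, path G x p && (last x p == y)].

(* [None] stands for infinity.  Searching the lengths below [#|V|] is enough,
   since a shortest walk does not repeat a vertex; see [distP]. *)
Definition dist (V : finType) (G : sgraph V) (x y : V) : option nat :=
  ohead [seq k <- iota 0 #|V| | has_walk G k x y].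

(* [None] stands for infinity, i.e. [G] is disconnected. *)
Definition diam (V : finType) (G : sgraph V) : option nat :=
  if [forall x, forall y, isSome (dist G x y)]
  then Some (\max_(x : V) \max_(y : V) odflt 0 (dist G x y))
  else None.

Lemma has_walkP (V : finType) (G : sgraph V) (k : nat) (x y : V) :
  reflect (exists p : seq V, [/\ size p = k, path G x p & last x p = y])
          (has_walk G k x y).
Proof.
apply: (iffP existsP) => [[p /andP[Hp /eqP Hl]]|[p [Hs Hp Hl]]].
  by exists p; rewrite size_tuple.
by exists (Tuple (introT eqP Hs)); rewrite /= Hp Hl eqxx.
Qed.

Lemma has_walk_short (V : finType) (G : sgraph V) (k : nat) (x y : V) :
  has_walk G k x y -> exists2 j, j <= k & (j < #|V|) && has_walk G j x y.
Proof.
case/has_walkP=> p [<- Hp Hl].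
case/shortenP: Hp Hl => p' Hp' Hu Hsub Hl.
exists (size p'); first by apply: uniq_leq_size => //; case/andP: Hu.
apply/andP; split; last by apply/has_walkP; exists p'.
by have := card_uniqP Hu => /= <-; apply: max_card.
Qed.

Lemma distP (V : finType) (G : sgraph V) (x y : V) (k : nat) :
  dist G x y = Some k <->
  has_walk G k x y /\ (forall j, has_walk G j x y -> k <= j).
Proof.
rewrite /dist; set s := filter _ _.
have Hmem j : (j \in s) = has_walk G j x y && (j < #|V|).
  by rewrite mem_filter mem_iota add0n.
have Hsort : sorted leq s.
  by apply: sorted_filter; [exact: leq_trans | exact: iota_sorted].
split.
  case Es: s => [|k0 s'] //= [<-].
  have : k0 \in s by rewrite Es mem_head.
  rewrite Hmem => /andP[Hk _]; split=> // j /has_walk_short[i Hij Hi].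
  apply: leq_trans Hij; have : i \in s by rewrite Hmem andbC.
  move: Hsort; rewrite Es /= (path_sortedE leq_trans) => /andP[/allP Ha _].
  by rewrite inE => /predU1P[->|/Ha].
case=> Hk Hmin; have [i Hik /andP[Hi Hw]] := has_walk_short Hk.
have Eik : i = k by apply/eqP; rewrite eqn_leq Hik Hmin.
have : k \in s by rewrite Hmem Hk -Eik.
case Es: s => [|k0 s'] //= Hks.
have : k0 \in s by rewrite Es mem_head.
rewrite Hmem => /andP[/Hmin Hk0 _]; congr Some; apply/eqP.
rewrite eqn_leq Hk0 andbT.
move: Hsort; rewrite Es /= (path_sortedE leq_trans) => /andP[/allP Ha _].
by move: Hks; rewrite inE => /predU1P[->|/Ha].
Qed.

(* [(x, y) \in A] is the arc from [x] to [y]: every edge of [G] carries exactly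
   one of its two directions, and non-edges carry none. *)
Definition is_orientation (V : finType) (G : sgraph V) (A : {set V * V}) :=
  [forall x, forall y,
     if G x y then ((x, y) \in A) (+) ((y, x) \in A) else (x, y) \notin A].

Record orientation (V : finType) (G : sgraph V) := Orientation {
  arcs :> {set V * V};
  arcsP : is_orientation G arcs
}.

HB.instance Definition _ (V : finType) (G : sgraph V) :=
  [isSub for @arcs V G].
HB.instance Definition _ (V : finType) (G : sgraph V) :=
  [Finite of orientation G by <:].

Definition invert_arcs (V : finType) (X : {set V}) (A : {set V * V}) :
    {set V * V} :=
  [set a : V * V |
     if (a.1 \in X) && (a.2 \in X) then (a.2, a.1) \in A else a \in A].

Lemma invert_subproof (V : finType) (G : sgraph V) (X : {set V})
    (A : orientation G) : is_orientation G (invert_arcs X A).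
Proof.
have HA x y := forallP (forallP (arcsP A) x) y.
apply/forallP=> x; apply/forallP=> y; rewrite !inE /= (andbC (y \in X)).
have := HA x y; have := HA y x; rewrite (adj_sym G y x).
by case: (G x y); case: ifP => // _ Hyx _; rewrite 1?addbC.
Qed.

Definition invert (V : finType) (G : sgraph V) (X : {set V})
    (A : orientation G) : orientation G :=
  Orientation (invert_subproof X A).

(* Simple graphs have no loops, whereas e.g. the inversion of the empty set
   fixes every orientation; hence the condition [A != B]. *)
Definition inversion_adj (V : finType) (G : sgraph V) : rel (orientation G) :=
  fun A B => (A != B) && [exists X : {set V}, invert X A == B].

Lemma invertK (V : finType) (G : sgraph V) (X : {set V}) :
  involutive (@invert V G X).
Proof.
move=> A; apply/val_inj/setP=> -[x y]; rewrite !inE /=.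
by case: (x \in X); case: (y \in X).
Qed.

Lemma inversion_adj_sym (V : finType) (G : sgraph V) :
  symmetric (@inversion_adj V G).
Proof.
suff H (A B : orientation G) : inversion_adj A B -> inversion_adj B A.
  by move=> A B; apply/idP/idP; apply: H.
case/andP=> HAB /existsP[X /eqP HX]; rewrite /inversion_adj eq_sym HAB /=.
by apply/existsP; exists X; rewrite -HX invertK.
Qed.

Lemma inversion_adj_irrefl (V : finType) (G : sgraph V) :
  irreflexive (@inversion_adj V G).
Proof. by move=> A; rewrite /inversion_adj eqxx. Qed.

Definition inversion_graph (V : finType) (G : sgraph V) :
    sgraph (orientation G) :=
  SGraph (@inversion_adj_sym V G) (@inversion_adj_irrefl V G).

(* Main.v *)
Require Import Defs.
From mathcomp Require Import all_boot.

Set Implicit Arguments.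
Unset Strict Implicit.
Unset Printing Implicit Defensive.

(** Writing [p x y] for the bit telling whether two orientations disagree on
    the edge [xy], three inversions lead from one to the other iff there is
    [f : V -> F_2^3] with [f x . f y = p x y] on every edge.

    A vertex all of whose labels are 0 may be sent to 0, so its labels may be
    changed to 1 first; afterwards every non-isolated vertex has an edge
    labelled 1.  In a connected component choose a small core [K] and colour
    the other vertices greedily by nonzero vectors, in the reverse of an order
    that grows from [K] along edges labelled 0 whenever possible.  The vector
    of a vertex with [i] coloured neighbours ranges over an affine space of
    [2^(3-i)] elements and has to avoid 0 and at most one value for each
    uncoloured neighbour.  This fails only if [i = 2] and both labels are 0; the
    last neighbour is joined by an edge labelled 1, and the choice of the
    order makes its condition void.

    The core is a vertex of degree at most 2, or else a triangle, or else a
    4-cycle containing an edge labelled 1, or else an edge labelled 1 together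
    with the neighbours of its ends along edges labelled 0.  Extending the
    colouring to the core is a finite problem over [F_2^3]; triangles and
    4-cycles have a few bad boundary values, which the greedy phase avoids. *)

(** * Linear algebra over [F_2^3] *)

Definition vec : Type := bool * bool * bool.

Definition dot (x y : vec) : bool :=
  (x.1.1 && y.1.1) (+) (x.1.2 && y.1.2) (+) (x.2 && y.2).

Definition vec0 : vec := (false, false, false).
Definition vec1 : vec := (true, true, true).

Definition nzvecs : seq vec :=
  [:: (true, false, false); (false, true, false); (false, false, true);
      (true, true, false); (true, false, true); (false, true, true); vec1].

Definition vecs : seq vec := vec0 :: nzvecs.

Lemma dotC x y : dot x y = dot y x.
Proof. by case: x y => [[[] []] []] [[[] []] []]. Qed.

Lemma all_vecs (P : pred vec) : all P vecs -> forall x, P x.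
Proof. by move=> /allP Pv [[[] []] []]; apply: Pv. Qed.

Lemma all_nzvecs (P : pred vec) : all P nzvecs -> forall x, x != vec0 -> P x.
Proof. by move=> /allP Pv [[[] []] []] // _; apply: Pv. Qed.



Definition dot_is (x y : vec) (q : bool) : bool := dot x y (+) ~~ q.

Lemma dot_isP x y q : reflect (dot x y = q) (dot_is x y q).
Proof. by rewrite /dot_is; case: (dot x y); case: q; constructor. Qed.

(** Like [dot_is], a bare Boolean formula on which the exhaustive checks by [vm_compute] run
    directly. *)
Definition vneq (x y : vec) : bool :=
  [|| x.1.1 (+) y.1.1, x.1.2 (+) y.1.2 | x.2 (+) y.2].

Lemma vneqE x y : (x != y) = vneq x y.
Proof. by case: x y => [[[] []] []] [[[] []] []]. Qed.


Lemma pick0 (x1 x2 x3 : vec) :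
  exists2 y, y != vec0 & [&& y != x1, y != x2 & y != x3].
Proof.
suff /hasP[y] : has (fun y => [&& vneq y x1, vneq y x2 & vneq y x3]) nzvecs.
  by move=> nzy; rewrite -!vneqE; exists y => //; apply: contraTneq nzy => ->.
move: x3; apply: all_vecs; move: x2; apply: all_vecs; move: x1; apply: all_vecs.
by vm_compute.
Qed.

(** The solutions of one equation form an affine plane of 4 vectors, and at most 3 are forbidden: 0,
    [x1] and [x2]. *)
Lemma pick1 (g : vec) (q : bool) (x1 x2 : vec) : g != vec0 ->
  exists2 y, y != vec0 & [&& dot y g == q, y != x1 & y != x2].
Proof.
move=> z; suff /hasP[y] :
    has (fun y => [&& dot_is y g q, vneq y x1 & vneq y x2]) nzvecs.
  move=> nzy; rewrite -!vneqE => /andP[/dot_isP/eqP dy h].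
  by exists y; [apply: contraTneq nzy => -> | rewrite dy].
move: x2; apply: all_vecs; move: x1; apply: all_vecs; move: g z; apply: all_nzvecs.
by case: q; vm_compute.
Qed.

(** For [g1 != g2] there are two solutions: if [q1 || q2], 0 is not one of them and [x] excludes at
    most one; otherwise 0 is one of them and [x] is 0. For [g1 = g2] the equations coincide and
    leave four. *)
Lemma pick2 (g1 g2 : vec) (q1 q2 : bool) (x : vec) :
    g1 != vec0 -> g2 != vec0 -> (q1 != q2 -> g1 != g2) ->
    (~~ (q1 || q2) -> x = vec0) ->
  exists2 y, y != vec0 & [&& dot y g1 == q1, dot y g2 == q2 & y != x].
Proof.
move=> z1 z2; rewrite vneqE => /implyP d x0.
have {x0} : (q1 || q2) || ~~ vneq x vec0.
  by have := x0; case: (q1 || q2) => //= ->.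
move=> x0; suff /hasP[y] :
    has (fun y => [&& dot_is y g1 q1, dot_is y g2 q2 & vneq y x]) nzvecs.
  move=> nzy; rewrite -!vneqE => /and3P[/dot_isP/eqP d1 /dot_isP/eqP d2 h].
  by exists y; [apply: contraTneq nzy => -> | rewrite d1 d2].
apply: implyP x0; apply: implyP d; move: x; apply: all_vecs.
move: g2 z2; apply: all_nzvecs; move: g1 z1; apply: all_nzvecs.
by case: q1; case: q2; vm_compute.
Qed.

(** [cs] lists vectors and labels of coloured neighbours, [X] the values forbidden by uncoloured
    ones. As [X] is nonempty, [cs] has at most two entries, which leaves the three preceding
    cases. *)
Lemma pick_vec (cs : seq (vec * bool)) (X : seq vec) :
    0 < size X -> size cs + size X <= 3 ->
    {in cs, forall c, c.1 != vec0} ->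
    {in cs &, forall c d, c.2 != d.2 -> c.1 != d.1} ->
    (size cs = 2 -> ~~ has snd cs -> {in X, forall x, x = vec0}) ->
  exists y, [/\ y != vec0, {in cs, forall c, dot y c.1 = c.2} & y \notin X].
Proof.
(* Entries missing from [X] read as [vec0], which is forbidden anyway. *)
have inX (y : vec) k : size X <= k ->
    y != vec0 -> all (fun i => y != nth vec0 X i) (iota 0 k) -> y \notin X.
  move=> sX y0 /allP h; apply/negP=> yX; have := h (index y X).
  rewrite mem_iota add0n nth_index // eqxx (leq_trans _ sX) ?index_mem //.
  by move/(_ isT).
case: cs => [|c [|d [|? ?]]] /= sX0 sX nz dif fz.
- have [y y0 hy] := pick0 (nth vec0 X 0) (nth vec0 X 1) (nth vec0 X 2).
  by exists y; split=> //; apply: (inX _ 3) => //=; rewrite andbT.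
- have [y y0 /and3P[/eqP dy h1 h2]] := pick1 c.2 (nth vec0 X 0) (nth vec0 X 1)
    (nz c (mem_head _ _)).
  exists y; split=> // [c'|]; first by rewrite inE => /eqP->.
  by apply: (inX _ 2) => //=; rewrite h1 h2.
- have cC : c \in [:: c; d] by rewrite mem_head.
  have dC : d \in [:: c; d] by rewrite !inE eqxx orbT.
  have [|y y0 /and3P[/eqP d1 /eqP d2 h]] :=
      @pick2 c.1 d.1 c.2 d.2 (nth vec0 X 0) (nz _ cC) (nz _ dC) (dif _ _ cC dC).
    by move=> n; apply: (fz erefl); rewrite ?orbF ?mem_nth.
  exists y; split=> // [c'|]; first by rewrite !inE => /orP[] /eqP->.
  by apply: (inX y 1 sX y0); rewrite /= h.
- by case: X sX0 sX {inX fz} => //= x X' _; rewrite addnS !addSn.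
Qed.

(** * Extension to a core by exhaustive checks *)

Definition close3_check (g1 g2 g3 : vec) (q1 q2 q3 p12 p23 p31 : bool) : bool :=
  has (fun y1 => has (fun y2 => has (fun y3 => dot_is y3 y1 p31)
    [seq y3 <- nzvecs | dot_is y3 g3 q3 && dot_is y2 y3 p23])
    [seq y2 <- nzvecs | dot_is y2 g2 q2 && dot_is y1 y2 p12])
    [seq y1 <- nzvecs | dot_is y1 g1 q1].

(** The [gi] are the vectors of the outer neighbours of a triangle, the [qi] the labels of the edges
    to them. The vector [vec1] is special because [dot y y = dot y vec1]: label 0 towards [vec1]
    forces a self-orthogonal vector. *)
Lemma close3 (g1 g2 g3 : vec) (q1 q2 q3 p12 p23 p31 : bool) :
    g1 != vec0 -> g2 != vec0 -> g3 != vec0 ->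
    [|| p31, p12 | q1] -> [|| p12, p23 | q2] -> [|| p23, p31 | q3] ->
    (if [|| q1, q2 | q3] then
       [&& q1 || (g1 != vec1), q2 || (g2 != vec1) & q3 || (g3 != vec1)]
     else (g1 != g2) || (g2 != g3)) ->
  exists y1 y2 y3, [/\ dot y1 g1 = q1, dot y2 g2 = q2 & dot y3 g3 = q3] /\
    [/\ dot y1 y2 = p12, dot y2 y3 = p23 & dot y3 y1 = p31].
Proof.
rewrite !(vneqE _ vec1) (vneqE g1 g2) (vneqE g2 g3) => z1 z2 z3 r1 r2 r3 c.
suff : close3_check g1 g2 g3 q1 q2 q3 p12 p23 p31.
  case/hasP=> y1; rewrite mem_filter => /andP[/dot_isP e1 _].
  case/hasP=> y2; rewrite mem_filter => /andP[/andP[/dot_isP e2 /dot_isP e12] _].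
  case/hasP=> y3; rewrite mem_filter => /andP[/andP[/dot_isP e3 /dot_isP e23] _].
  by move=> /dot_isP e31; exists y1, y2, y3.
apply: implyP c; apply: implyP r3; apply: implyP r2; apply: implyP r1.
move: g3 z3; apply: all_nzvecs; move: g2 z2; apply: all_nzvecs.
move: g1 z1; apply: all_nzvecs.
by case: q1; case: q2; case: q3; case: p12; case: p23; case: p31; vm_compute.
Qed.

(** Once two opposite corners have their values [y.1] and [y.2], the other two are chosen
    independently. The list does not involve [g1] and [g3], so [close4_check] reuses it for all of
    them. *)
Definition close4_pairs (g2 g4 : vec) (q2 q4 p23 p34 p41 : bool) : seq (vec * vec) :=
  [seq y <- allpairs pair nzvecs nzvecs |
    has (fun y2 => [&& dot_is y2 g2 q2, dot y.1 y2 & dot_is y2 y.2 p23]) nzvecs &&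
    has (fun y4 => [&& dot_is y4 g4 q4, dot_is y.2 y4 p34 & dot_is y4 y.1 p41])
      nzvecs].

Definition close4_check (g2 g4 : vec) (q1 q2 q3 q4 : bool) (s : seq (vec * vec)) : bool :=
  all (fun g1 => all (fun g3 =>
    [|| q1, q2, q3, q4, vneq g1 g3 | vneq g2 g4] ==>
    has (fun y => dot_is y.1 g1 q1 && dot_is y.2 g3 q3) s) nzvecs) nzvecs.

Lemma close4 (g1 g2 g3 g4 : vec) (q1 q2 q3 q4 p23 p34 p41 : bool) :
    g1 != vec0 -> g2 != vec0 -> g3 != vec0 -> g4 != vec0 ->
    [|| p23, p34 | q3] -> [|| p34, p41 | q4] ->
    [|| q1, q2, q3, q4, g1 != g3 | g2 != g4] ->
  exists y1 y2 y3 y4,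
    [/\ dot y1 g1 = q1, dot y2 g2 = q2, dot y3 g3 = q3 & dot y4 g4 = q4] /\
    [/\ dot y1 y2, dot y2 y3 = p23, dot y3 y4 = p34 & dot y4 y1 = p41].
Proof.
rewrite (vneqE g1 g3) (vneqE g2 g4) => z1 z2 z3 z4 r3 r4 c.
suff h : close4_check g2 g4 q1 q2 q3 q4 (close4_pairs g2 g4 q2 q4 p23 p34 p41).
  case/hasP: (implyP (all_nzvecs (all_nzvecs h z1) z3) c) => -[y1 y3].
  rewrite mem_filter => /andP[/andP[/hasP[y2 _ /and3P[]]]].
  move=> /dot_isP e2 e12 /dot_isP e23 /hasP[y4 _ /and3P[]].
  move=> /dot_isP e4 /dot_isP e34 /dot_isP e41 _ /andP[/dot_isP e1 /dot_isP e3].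
  by exists y1, y2, y3, y4.
move: g4 z4 {c}; apply: all_nzvecs; move: g2 z2; apply: all_nzvecs.
apply: implyP r4; apply: implyP r3.
by case: q1; case: q2; case: q3; case: q4; case: p23; case: p34; case: p41;
  vm_compute.
Qed.

(** Serves the ends [u] and [w] of an edge labelled 1; each other equation stands for one further
    neighbour of an end. As all right-hand sides are 1, coinciding coefficients do not conflict. *)
Lemma close_edge (g1 g2 g3 g4 : vec) :
    g1 != vec0 -> g2 != vec0 -> g3 != vec0 -> g4 != vec0 ->
  exists u w, [/\ dot u g1, dot u g2, dot w g3, dot w g4 & dot u w].
Proof.
move=> z1 z2 z3 z4.
suff : has (fun u => [&& dot u g1, dot u g2 &
    has (fun w => [&& dot w g3, dot w g4 & dot u w]) nzvecs]) nzvecs.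
  case/hasP=> u _ /and3P[? ?] /hasP[w _ /and3P[? ? ?]].
  by exists u, w.
move: g4 z4; apply: all_nzvecs; move: g3 z3; apply: all_nzvecs.
move: g2 z2; apply: all_nzvecs; move: g1 z1; apply: all_nzvecs.
by vm_compute.
Qed.

(** The two equations have distinct solutions [s] and [s']. For [h := s + s'], [dot u h] says that
    exactly one of them is orthogonal to [u]. The check finds a suitable [h] by search. *)
Lemma pivot (g1 g2 : vec) (q1 q2 : bool) :
    g1 != vec0 -> g2 != vec0 -> q1 || q2 -> (q1 != q2 -> g1 != g2) ->
  exists2 h, h != vec0 & forall u, dot u h ->
    exists s, [/\ dot s g1 = q1, dot s g2 = q2 & dot u s = false].
Proof.
rewrite (vneqE g1 g2) => z1 z2 q12 /implyP d.
suff /hasP[h nzh /allP hh] : has (fun h => all (fun u => dot u h ==>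
    has (fun s => [&& dot_is s g1 q1, dot_is s g2 q2 & dot_is u s false]) nzvecs)
    vecs) nzvecs.
  exists h => [|u uh]; first by apply: contraTneq nzh => ->.
  have /hasP[s _ /and3P[]] : has (fun s => [&& dot_is s g1 q1, dot_is s g2 q2 & dot_is u s false]) nzvecs.
    by apply: (implyP _ uh); apply: hh; case: (u) => [[[] []] []].
  by move=> /dot_isP ? /dot_isP ? /dot_isP ?; exists s.
apply: implyP d; apply: implyP q12; move: g2 z2; apply: all_nzvecs; move: g1 z1; apply: all_nzvecs.
by case: q1; case: q2; vm_compute.
Qed.

(** * Greedy colouring outside a core *)

Section Greedy.

Variables (V : finType) (e : rel V) (p : V -> V -> bool).
Hypotheses (e_sym : symmetric e) (e_irr : irreflexive e).
Hypothesis p_sym : forall x y, p x y = p y x.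
Hypothesis deg3 : forall x, #|[set y | e x y]| <= 3.
Hypothesis has1 : forall x y, e x y -> exists2 z, e x z & p x z.
Variables (C K F : {set V}) (D : rel V) (E : pred V).
Hypothesis C_closed : forall x y, x \in C -> e x y -> y \in C.
Hypothesis C_conn : forall R : {set V}, R \subset C -> R != set0 -> R != C ->
  exists s t, [/\ s \in R, t \in C :\: R & e s t].
Hypotheses (KC : K \subset C) (K0 : K != set0) (FK : F \subset K).
Hypothesis K_bd : forall s, s \in K :\: F -> #|[set y | e s y] :\: K| <= 2.
Hypotheses (D_sym : symmetric D) (D_irr : irreflexive D).
Hypothesis D_uniq : forall x y z, D x y -> D x z -> y = z.
Hypothesis DE : forall x y, E x -> ~~ D x y.
Hypothesis D_free : forall x y, D x y -> exists2 s, s \in F & e x s && ~~ p x s.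
Hypothesis E_free : forall x, E x -> exists2 s, s \in F & e x s && ~~ p x s.

(* [R] is the set of uncoloured vertices.  The vertices of [F] put no condition
   on their coloured neighbours; instead, boundary vertices of the core paired
   by [D] must get distinct vectors and those in [E] must avoid (1, 1, 1). *)
Definition partial (R : {set V}) (f : V -> vec) : Prop :=
  [/\ {in C :\: R, forall x, f x != vec0},
      {in C :\: R &, forall x y, e x y -> dot (f x) (f y) = p x y},
      {in R :\: F, forall s, {in C :\: R &, forall x y,
        e s x -> e s y -> p s x != p s y -> f x != f y}},
      {in C :\: R &, forall x y, D x y -> f x != f y}
    & {in C :\: R, forall x, E x -> f x != vec1}].

(** When a vertex [t] outside [R] gets its vector, a neighbour in [R] but not in [F] has at most one
    other coloured neighbour, hence forbids at most one value. *)
Definition bounded (R : {set V}) : Prop :=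
  forall s, s \in R :\: F -> #|[set y | e s y] :\: R| <= 2.

(** The vector of [t] solves one equation per coloured neighbour and avoids one value per neighbour
    in [R]. These are at most three conditions, and [s0] is among the latter, so [pick_vec] applies;
    the last premise on [R] settles its exceptional case. *)
Lemma partial_step (R : {set V}) t s0 (f : V -> vec) :
    K \subset R -> R \subset C -> bounded R -> t \in C :\: R ->
    s0 \in R -> e t s0 ->
    (p t s0 -> {in R, forall s x, e s x -> ~~ p s x -> x \in R}) ->
  partial (t |: R) f -> exists f', partial R f'.
Proof.
move=> KR RC bR tCR s0R ets0 clo [f0 fe f3 fD fE].
have [tC tR] : t \in C /\ t \notin R by move: tCR; rewrite inE => /andP[].
pose N := [set y | e t y]; pose P := C :\: (t |: R).
have PE x : (x \in P) = [&& x != t, x \notin R & x \in C].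
  by rewrite !inE negb_or andbA.
(* The value that a neighbour [s] forbids to [t]; [vec0] adds nothing to being nonzero. Conditions
   from [D] and [E] are charged to neighbours in [F], which have none of their own. *)
pose excl s := if s \in F then
    (if E t then vec1 else if [pick y | D t y] is Some y then f y else vec0)
  else if [pick y | [&& y \in P, e s y & p s y != p s t]] is Some y then f y
  else vec0.
pose cs := [seq (f x, p t x) | x <- enum (N :\: R)].
pose X := [seq excl s | s <- enum (N :&: R)].
have NP x : x \in N :\: R -> x \in P.
  rewrite PE !inE => /andP[-> etx]; rewrite (C_closed tC etx) /= andbT.
  by apply: contraTneq etx => ->; rewrite e_irr.
have [y [y0 hy yX]] : exists y, [/\ y != vec0,
    {in cs, forall c, dot y c.1 = c.2} & y \notin X].
  apply: pick_vec.
  - by rewrite size_map -cardE (cardD1 s0) !inE ets0 s0R.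
  - by rewrite !size_map -!cardE addnC cardsID deg3.
  - move=> c /mapP[x xN ->]; rewrite mem_enum in xN.
    exact: f0 (NP x xN).
  - move=> c c' /mapP[x xN ->] /mapP[z zN ->] /=.
    rewrite !mem_enum in xN zN.
    move=> d; apply: (f3 t) => //; try exact: NP.
    + rewrite !inE eqxx andbT; apply: contra tR; apply/subsetP.
      exact: subset_trans FK KR.
    + by move: xN; rewrite !inE => /andP[].
    + by move: zN; rewrite !inE => /andP[].
  (* With two coloured neighbours, both along label 0, [s0] is the only neighbour in [R], and [has1]
     puts label 1 on the edge to it. *)
  rewrite size_map -cardE => c2 /hasPn c0 v /mapP[s + ->].
  rewrite mem_enum => sNR.
  have Ns : N :&: R = [set s0].
    apply/esym/eqP; rewrite eqEcard sub1set !inE ets0 s0R cards1.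
    by have := deg3 t; rewrite -(cardsID R) -/N c2 -[3]/(1 + 2) leq_add2r.
  move: sNR; rewrite Ns inE => /eqP -> {s}.
  have c0' x : x \in N :\: R -> p t x = false.
    move=> xN; apply: negbTE; apply: (c0 (f x, p t x)).
    by apply/mapP; exists x; rewrite ?mem_enum.
  have pts0 : p t s0.
    have [z etz ptz] := has1 ets0; suff /eqP<- : z == s0 by [].
    rewrite -in_set1 -Ns !inE etz; apply: contraLR ptz => zR.
    by rewrite c0' // !inE etz zR.
  have nF s : s \in F -> e t s -> p t s.
    move=> sF ets; suff /eqP-> : s == s0 by [].
    by rewrite -in_set1 -Ns !inE ets (subsetP KR) ?(subsetP FK).
  (* A condition from [D] or [E] would need an edge labelled 0 from [t] to [F]. By [clo], every
     coloured neighbour of [s0] is joined to it by label 1, as [t] is, so none forces a distinct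
     vector. *)
  rewrite /excl; case: ifP => _.
    case: ifP => [/E_free[s sF /andP[ets]]|_]; first by rewrite nF.
    case: pickP => // z /D_free[s sF /andP[ets]]; by rewrite nF.
  case: pickP => // z /and3P[zP es0z]; rewrite (p_sym s0 t) pts0 => pz.
  have := clo pts0 s0 s0R z es0z; move: pz; rewrite PE in zP.
  by case: (p s0 z) => // _ /(_ isT) zR; move: zP; rewrite zR andbF.
have yexcl s : e t s -> s \in R -> y != excl s.
  move=> ets sR; apply: contraNneq yX => ->; apply/mapP; exists s => //.
  by rewrite mem_enum !inE ets.
have yN x : x \in N :\: R -> dot y (f x) = p t x.
  move=> xN; apply: (hy (f x, p t x)); apply/mapP.
  by exists x; rewrite ?mem_enum.
pose f' x := if x == t then y else f x.
have f't : f' t = y by rewrite /f' eqxx.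
have f'P x : x \in P -> f' x = f x by rewrite PE /f' => /andP[/negPf->].
have CR x : x \in C :\: R -> x = t \/ x \in P.
  rewrite inE PE; case: eqVneq => [->|]; first by left.
  by move=> _ /andP[-> ->]; right.
exists f'; split.
- by move=> x /CR[->|xP]; rewrite ?f't ?f'P //; apply: f0.
- move=> x z /CR[->|xP] /CR[->|zP]; rewrite ?f't ?f'P ?e_irr //.
  + by move=> etz; apply: yN; move: zP; rewrite PE !inE etz => /and3P[_ ->].
  + rewrite e_sym => etx; rewrite dotC p_sym; apply: yN.
    by move: xP; rewrite PE !inE etx => /and3P[_ ->].
  + exact: fe.
- move=> s sRF.
  have [sF sR] : s \notin F /\ s \in R by move: sRF; rewrite inE => /andP[].
  have key z : z \in P -> e s t -> e s z -> p s t != p s z -> y != f z.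
    move=> zP est esz d; have := yexcl s; rewrite e_sym => /(_ est sR).
    rewrite /excl (negPf sF); case: pickP => [z'|/(_ z)]; last first.
      by rewrite zP esz eq_sym d.
    case/and3P=> z'P esz' d'; suff -> : z = z' by [].
    have tzP u : u \in P -> t != u by rewrite PE eq_sym => /andP[].
    (* Otherwise [t], [z] and [z'] would be three neighbours of [s] outside [R]. *)
    apply: contraTeq (bR s sRF) => zz'; rewrite -ltnNge.
    have <- : #|t |: [set z; z']| = 3.
      by rewrite cardsU1 cards2 !inE negb_or !tzP // zz'.
    apply/subset_leq_card/subsetP=> u; rewrite !inE => /or3P[] /eqP-> //.
    + by rewrite tR est.
    + by move: zP; rewrite PE esz => /and3P[_ ->].
    + by move: z'P; rewrite PE esz' => /and3P[_ ->].
  move=> x z /CR[->|xP] /CR[->|zP]; rewrite ?f't ?f'P ?eqxx //.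
  + exact: key.
  + by move=> esx est d; rewrite eq_sym; apply: key; rewrite // eq_sym.
  + by apply: (f3 s) => //; rewrite !inE sF sR orbT.
- have key z : D t z -> y != f z.
    move=> Dtz; have [s sF /andP[ets _]] := D_free Dtz.
    have := yexcl s ets; rewrite (subsetP KR) ?(subsetP FK) // /excl sF.
    move=> /(_ isT); case: ifP => [Et|_]; first by have := @DE t z Et; rewrite Dtz.
    by case: pickP => [z' /(D_uniq Dtz)->|/(_ z)] //; rewrite Dtz.
  move=> x z /CR[->|xP] /CR[->|zP]; rewrite ?f't ?f'P ?D_irr //.
  + exact: key.
  + by rewrite D_sym eq_sym; apply: key.
  + exact: fD.
- move=> x /CR[->|xP]; rewrite ?f't ?f'P //; last exact: fE.
  move=> Et; have [s sF /andP[ets _]] := E_free Et.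
  have := yexcl s ets; rewrite (subsetP KR) ?(subsetP FK) // /excl sF Et.
  exact.
Qed.

(** Induction on the number of vertices outside [R]: [R] grows from [K] to [C], and the last vertex
    added is coloured first. The next vertex is reached along an edge labelled 0 if one leaves [R];
    if none does, [R] is closed along label 0, as [partial_step] asks. *)
Lemma greedy : exists f, partial K f.
Proof.
suff main n (R : {set V}) : #|C :\: R| <= n -> K \subset R -> R \subset C ->
    bounded R -> exists f, partial R f.
  exact: (main _ K (leqnn _) (subxx _) KC K_bd).
elim: n R => [|n IHn] R.
  rewrite leqn0 cards_eq0 => /eqP CR _ _ _; exists (fun=> vec0).
  by split=> [x|x y|s _ x y|x y|x]; rewrite CR inE.
move=> cR KR RC bR; have [CR|nCR] := eqVneq R C.
  exists (fun=> vec0); have CR0 : C :\: R = set0 by rewrite CR setDv.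
  by split=> [x|x y|s _ x y|x y|x]; rewrite CR0 inE.
have step t s0 : t \in C :\: R -> s0 \in R -> e t s0 ->
    (p t s0 -> {in R, forall s x, e s x -> ~~ p s x -> x \in R}) ->
    exists f, partial R f.
  move=> tCR s0R ets0 clo; have [tR tC] := setDP tCR.
  have [] := IHn (t |: R).
  - rewrite -ltnS; apply: leq_trans cR; apply: proper_card.
    by rewrite properE setDS ?subsetUr //=; apply/subsetPn; exists t; rewrite // !inE eqxx.
  - exact: subset_trans KR (subsetUr _ _).
  - by rewrite subUset sub1set tR.
  - move=> s; rewrite !inE => /andP[sF /predU1P[->|sR]].
      (* The new vertex [t] has its neighbour [s0] in [R], so at most two neighbours lie outside. *)
      rewrite -ltnS; apply: leq_trans (deg3 t).
      rewrite [leqRHS](cardsD1 s0) inE ets0 ltnS subset_leq_card //.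
      apply/subsetP=> x; rewrite !inE negb_or => /andP[/andP[_ xR] ->].
      by rewrite andbT; apply: contraNneq xR => ->.
    apply: leq_trans (bR s _); last by rewrite inE sF.
    by rewrite subset_leq_card // setDS ?subsetUr.
  by move=> f; apply: partial_step tCR s0R ets0 clo.
have [/exists_inP[s sR /existsP[x /and3P[esx psx xR]]]|clo] := boolP
    [exists s in R, exists x, [&& e s x, ~~ p s x & x \notin R]].
  apply: (step x s); rewrite // 1?e_sym //; last by rewrite p_sym (negPf psx).
  by rewrite inE xR (C_closed _ esx) // (subsetP RC).
have R0 : R != set0 by apply: contraNneq K0 => R0; rewrite -subset0 -R0.
have [s [t [sR tCR est]]] := C_conn RC R0 nCR.
apply: (step t s); rewrite // 1?e_sym // => _ s' s'R x es'x ps'x.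
apply: contraNT clo => xR; apply/exists_inP; exists s' => //.
by apply/existsP; exists x; rewrite es'x ps'x.
Qed.

End Greedy.

(** * Cores of a connected component *)

Section Component.

Variables (V : finType) (e : rel V) (p : V -> V -> bool).
Hypotheses (e_sym : symmetric e) (e_irr : irreflexive e).
Hypothesis p_sym : forall x y, p x y = p y x.
Hypothesis deg3 : forall x, #|[set y | e x y]| <= 3.
Hypothesis has1 : forall x y, e x y -> exists2 z, e x z & p x z.
Variable C : {set V}.
Hypothesis C_closed : forall x y, x \in C -> e x y -> y \in C.
Hypothesis C_conn : forall R : {set V}, R \subset C -> R != set0 -> R != C ->
  exists s t, [/\ s \in R, t \in C :\: R & e s t].

Definition solvable : Prop :=
  exists f : V -> vec, {in C &, forall x y, e x y -> dot (f x) (f y) = p x y}.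

Lemma edge_neq x y : e x y -> x != y.
Proof. by move=> exy; apply: contraTneq exy => ->; rewrite e_irr. Qed.

Lemma extend (K F : {set V}) (D : rel V) (E : pred V) f f' :
    partial e p C F D E K f -> {in [predC K], f' =1 f} ->
    (forall x y, x \in K -> e x y -> dot (f' x) (f' y) = p x y) ->
  solvable.
Proof.
move=> [_ fe _ _ _] f'f f'K; exists f' => x y xC yC exy.
have [xK|xK] := boolP (x \in K); first exact: f'K.
have [yK|yK] := boolP (y \in K).
  by rewrite dotC p_sym f'K // e_sym.
by rewrite !f'f //; apply: fe; rewrite // inE ?xK ?yK.
Qed.

Lemma third_nbr x y z : #|[set u | e x u]| = 3 -> e x y -> e x z -> y != z ->
  exists a, [/\ a != y, a != z & forall u, e x u = [|| u == y, u == z | u == a]].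
Proof.
move=> d exy exz yz; have := d; rewrite (cardsD1 y) (cardsD1 z) !inE exy exz.
rewrite eq_sym yz => -[/eqP/cards1P[a ha]].
have : a \in [set a] by rewrite inE.
rewrite -ha !inE => /and3P[az ay exa]; exists a; split=> // u.
have := congr1 (fun A : {set V} => u \in A) ha; rewrite !inE => <-.
case: (eqVneq u y) => [->|] //=; case: (eqVneq u z) => [->|] //=.
Qed.

Lemma other_nbrs x y : #|[set u | e x u]| = 3 -> e x y ->
  exists a b, [/\ a != y, b != y, a != b &
    forall u, e x u = [|| u == y, u == a | u == b]].
Proof.
move=> d exy; have [z exz yz] : exists2 z, e x z & y != z.
  have : 0 < #|[set u | e x u] :\ y|.
    by move: d; rewrite (cardsD1 y) inE exy; case: #|_|.
  by case/card_gt0P=> z; rewrite !inE => /andP[zy exz]; exists z; rewrite // eq_sym.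
have [a [ay az N]] := third_nbr d exy exz yz.
by exists z, a; split; rewrite // eq_sym.
Qed.

Lemma has1_3 x a b c : (forall u, e x u = [|| u == a, u == b | u == c]) ->
  [|| p x a, p x b | p x c].
Proof.
move=> N; have [|z] := @has1 x a; first by rewrite N eqxx.
by rewrite N => /or3P[] /eqP-> ->; rewrite ?orbT.
Qed.

(** The core is [x] alone, with [F] empty, so [partial] makes the at most two equations at [x]
    consistent; only 0 is to be avoided. *)
Lemma solvable_deg2 x : x \in C -> #|[set y | e x y]| <= 2 -> solvable.
Proof.
move=> xC d2; pose noD : rel V := fun _ _ => false.
have [||||||||||f hf] := @greedy V e p e_sym e_irr p_sym deg3 has1 C [set x] set0
  noD pred0 C_closed C_conn.
- by rewrite sub1set.
- by apply/set0Pn; exists x; rewrite inE.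
- exact: sub0set.
- move=> s; rewrite !inE /= => /eqP ->; apply: leq_trans d2.
  by rewrite subset_leq_card // subsetDl.
- by [].
- by [].
- by [].
- by [].
- by [].
- by [].
have [f0 fe f3 _ _] := hf.
have out y : e x y -> y \in C :\: [set x].
  by move=> exy; rewrite !inE eq_sym (edge_neq exy) (C_closed xC exy).
pose cs := [seq (f y, p x y) | y <- enum [set y | e x y]].
have inN y : y \in enum [set y | e x y] -> e x y by rewrite mem_enum inE.
have [y [_ hy _]] : exists y, [/\ y != vec0,
    {in cs, forall c, dot y c.1 = c.2} & y \notin [:: vec0]].
  apply: pick_vec => //.
  - by rewrite size_map -cardE addn1 ltnS.
  - by move=> c /mapP[y /inN exy ->]; apply: f0; apply: out.
  - move=> c c' /mapP[y /inN exy ->] /mapP[z /inN exz ->] /=.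
    by apply: (f3 x); rewrite ?out // !inE eqxx.
  - by move=> _ _ v; rewrite inE => /eqP.
apply: (@extend _ _ _ _ f (fun u => if u == x then y else f u) hf).
  by move=> u; rewrite !inE => /negPf->.
move=> u z; rewrite inE => /eqP-> exz; rewrite eqxx eq_sym (negPf (edge_neq exz)).
by apply: (hy (f z, p x z)); apply/mapP; exists z; rewrite ?mem_enum ?inE.
Qed.

(** * Triangle cores in a cubic component *)

Hypothesis cubic : {in C, forall x, #|[set y | e x y]| = 3}.

(** The instance of [D] that separates just [a] and [b]. *)
Definition pair_rel (a b : V) : rel V :=
  fun x y => (x == a) && (y == b) || (x == b) && (y == a).

Lemma pair_rel_sym a b : symmetric (pair_rel a b).
Proof. by move=> x y; rewrite /pair_rel orbC !(andbC (x == _)). Qed.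

Lemma pair_rel_irr a b : a != b -> irreflexive (pair_rel a b).
Proof.
move=> ab x; rewrite /pair_rel andbC orbb; case: eqP => // ->.
by rewrite eq_sym (negPf ab).
Qed.

Lemma pair_rel_uniq a b x y z : a != b ->
  pair_rel a b x y -> pair_rel a b x z -> y = z.
Proof.
move=> ab /orP[] /andP[/eqP-> /eqP->]; rewrite /pair_rel eqxx ?(negPf ab) /=.
  by rewrite orbF => /eqP.
by rewrite (eq_sym b) (negPf ab) => /eqP.
Qed.

Lemma triangle_extend (x1 x2 x3 o1 o2 o3 : V) (D : rel V) (E : pred V) f :
    x1 \in C -> e x1 x2 -> e x2 x3 -> e x3 x1 ->
    o1 != x2 -> o1 != x3 -> o2 != x1 -> o2 != x3 -> o3 != x1 -> o3 != x2 ->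
    (forall u, e x1 u = [|| u == x3, u == x2 | u == o1]) ->
    (forall u, e x2 u = [|| u == x1, u == x3 | u == o2]) ->
    (forall u, e x3 u = [|| u == x2, u == x1 | u == o3]) ->
    partial e p C [set x1; x2; x3] D E [set x1; x2; x3] f ->
    (if [|| p x1 o1, p x2 o2 | p x3 o3] then
       [&& p x1 o1 || (f o1 != vec1), p x2 o2 || (f o2 != vec1)
         & p x3 o3 || (f o3 != vec1)]
     else (f o1 != f o2) || (f o2 != f o3)) ->
  solvable.
Proof.
move=> x1C e12 e23 e31 o12 o13 o21 o23 o31 o32 N1 N2 N3 hf cond.
have n12 := edge_neq e12; have n23 := edge_neq e23; have n31 := edge_neq e31.
have x2C := C_closed x1C e12; have x3C := C_closed x2C e23.
have e1 : e x1 o1 by rewrite N1 eqxx !orbT.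
have e2 : e x2 o2 by rewrite N2 eqxx !orbT.
have e3 : e x3 o3 by rewrite N3 eqxx !orbT.
have n1 := edge_neq e1; have n2 := edge_neq e2; have n3 := edge_neq e3.
have [f0 _ _ _ _] := hf.
have [y1 [y2 [y3 [[h1 h2 h3] [h12 h23 h31]]]]] : exists y1 y2 y3,
    [/\ dot y1 (f o1) = p x1 o1, dot y2 (f o2) = p x2 o2
      & dot y3 (f o3) = p x3 o3] /\
    [/\ dot y1 y2 = p x1 x2, dot y2 y3 = p x2 x3 & dot y3 y1 = p x3 x1].
  apply: close3 cond.
  - by apply: f0; rewrite !inE (C_closed x1C e1) (negPf o12) (negPf o13) eq_sym (negPf n1).
  - by apply: f0; rewrite !inE (C_closed x2C e2) (negPf o21) (negPf o23) eq_sym (negPf n2).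
  - by apply: f0; rewrite !inE (C_closed x3C e3) (negPf o31) (negPf o32) eq_sym (negPf n3).
  - by have := has1_3 N1; rewrite (p_sym x1 x3).
  - by have := has1_3 N2; rewrite (p_sym x2 x1).
  - by have := has1_3 N3; rewrite (p_sym x3 x2).
pose f' u := if u == x1 then y1 else if u == x2 then y2 else
  if u == x3 then y3 else f u.
have F1 : f' x1 = y1 by rewrite /f' eqxx.
have F2 : f' x2 = y2 by rewrite /f' eqxx eq_sym (negPf n12).
have F3 : f' x3 = y3.
  by rewrite /f' eqxx (negPf n31) eq_sym (negPf n23).
have F u : u != x1 -> u != x2 -> u != x3 -> f' u = f u.
  by rewrite /f' => /negPf-> /negPf-> /negPf->.
have G1 : f' o1 = f o1 by rewrite F // eq_sym.
have G2 : f' o2 = f o2 by rewrite F // eq_sym.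
have G3 : f' o3 = f o3 by rewrite F // eq_sym.
apply: (extend (f' := f') hf) => [u|u z].
  by rewrite !inE !negb_or => /andP[/andP[? ?] ?]; apply: F.
rewrite !inE => /orP[/orP[]|] /eqP->.
- by rewrite N1 => /or3P[] /eqP->; rewrite F1 ?F2 ?F3 ?G1 // dotC p_sym.
- by rewrite N2 => /or3P[] /eqP->; rewrite F2 ?F1 ?F3 ?G2 // dotC p_sym.
- by rewrite N3 => /or3P[] /eqP->; rewrite F3 ?F1 ?F2 ?G3 // dotC p_sym.
Qed.

(** If some outer edge has label 1, [E] keeps [vec1] off the outer neighbours reached by label 0.
    Otherwise the outer neighbours must not all get one vector, and [D] separates two distinct
    ones. *)
Lemma solvable_triangle x1 x2 x3 :
  x1 \in C -> e x1 x2 -> e x2 x3 -> e x3 x1 -> solvable.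
Proof.
move=> x1C e12 e23 e31.
have e21 : e x2 x1 by rewrite e_sym.
have e32 : e x3 x2 by rewrite e_sym.
have e13 : e x1 x3 by rewrite e_sym.
have n12 := edge_neq e12; have n23 := edge_neq e23; have n31 := edge_neq e31.
have x2C := C_closed x1C e12; have x3C := C_closed x2C e23.
have [|o1 [o13 o12 N1]] := third_nbr (cubic x1C) e13 e12; first by rewrite eq_sym.
have [|o2 [o21 o23 N2]] := third_nbr (cubic x2C) e21 e23; first by rewrite eq_sym.
have [|o3 [o32 o31 N3]] := third_nbr (cubic x3C) e32 e31; first by rewrite eq_sym.
pose T := [set x1; x2; x3].
have TC : T \subset C.
  by apply/subsetP=> u; rewrite !inE => /orP[/orP[]|] /eqP->.
have T0 : T != set0 by apply/set0Pn; exists x1; rewrite !inE eqxx.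
have bT s : s \in T :\: T -> #|[set y | e s y] :\: T| <= 2.
  by rewrite setDv inE.
have e1 : e x1 o1 by rewrite N1 eqxx !orbT.
have e2 : e x2 o2 by rewrite N2 eqxx !orbT.
have e3 : e x3 o3 by rewrite N3 eqxx !orbT.
have n1 := edge_neq e1; have n2 := edge_neq e2; have n3 := edge_neq e3.
have oCT i o : i \in C -> e i o -> o != x1 -> o != x2 -> o != x3 -> o \in C :\: T.
  move=> iC ei m1 m2 m3; rewrite !inE (negPf m1) (negPf m2) (negPf m3).
  exact: C_closed ei.
have oC1 : o1 \in C :\: T by apply: (oCT x1) => //; rewrite eq_sym.
have oC2 : o2 \in C :\: T by apply: (oCT x2) => //; rewrite eq_sym.
have oC3 : o3 \in C :\: T by apply: (oCT x3) => //; rewrite eq_sym.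
have T1 : x1 \in T by rewrite !inE eqxx.
have T2 : x2 \in T by rewrite !inE eqxx orbT.
have T3 : x3 \in T by rewrite !inE eqxx orbT.
have [q|] := boolP [|| p x1 o1, p x2 o2 | p x3 o3].
  pose noD : rel V := fun _ _ => false.
  pose E u := [|| (u == o1) && ~~ p x1 o1, (u == o2) && ~~ p x2 o2
    | (u == o3) && ~~ p x3 o3].
  have [//|f hf] := greedy e_sym e_irr p_sym deg3 has1 C_closed C_conn TC T0
    (subxx T) bT (D := noD) (E := E) (fun _ _ => erefl) (fun _ => erefl)
    (fun _ _ _ h => match notF h with end) (fun _ _ _ => isT)
    (fun _ _ h => match notF h with end).
    move=> u /or3P[] /andP[/eqP-> n].
    - by exists x1; rewrite // e_sym e1 p_sym.
    - by exists x2; rewrite // e_sym e2 p_sym.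
    - by exists x3; rewrite // e_sym e3 p_sym.
  have [_ _ _ _ fE] := hf.
  apply: (triangle_extend x1C e12 e23 e31 o12 o13 o21 o23 o31 o32 N1 N2 N3 hf).
  rewrite q; apply/and3P; split; case: (boolP (p _ _)) => //= n; apply: fE => //.
  - by rewrite /E eqxx n.
  - by rewrite /E eqxx n orbT.
  - by rewrite /E eqxx n !orbT.
rewrite !negb_or => /and3P[q1 q2 q3].
have pairT a b (ab : a != b) : (exists2 i, i \in T & e a i && ~~ p a i) ->
    (exists2 i, i \in T & e b i && ~~ p b i) ->
    exists f, partial e p C T (pair_rel a b) pred0 T f.
  move=> ha hb; apply: (greedy e_sym e_irr p_sym deg3 has1 C_closed C_conn TC T0
    (subxx T) bT (pair_rel_sym a b) (pair_rel_irr ab)) => //.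
    by move=> x y z; apply: pair_rel_uniq.
  by move=> x y /orP[] /andP[/eqP-> _].
have w1 : exists2 i, i \in T & e o1 i && ~~ p o1 i.
  by exists x1; rewrite // e_sym e1 p_sym.
have w2 : exists2 i, i \in T & e o2 i && ~~ p o2 i.
  by exists x2; rewrite // e_sym e2 p_sym.
have w3 : exists2 i, i \in T & e o3 i && ~~ p o3 i.
  by exists x3; rewrite // e_sym e3 p_sym.
have fin f D : partial e p C T D pred0 T f -> (f o1 != f o2) || (f o2 != f o3) ->
    solvable.
  move=> hf cond.
  apply: (triangle_extend x1C e12 e23 e31 o12 o13 o21 o23 o31 o32 N1 N2 N3 hf).
  by rewrite (negPf q1) (negPf q2) (negPf q3).
have [o12E|d12] := eqVneq o1 o2; last first.
  have [f hf] := pairT _ _ d12 w1 w2; have [_ _ _ fD _] := hf.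
  by apply: (fin f _ hf); rewrite fD // /pair_rel !eqxx.
have [o23E|d23] := eqVneq o2 o3; last first.
  have [f hf] := pairT _ _ d23 w2 w3; have [_ _ _ fD _] := hf.
  by apply: (fin f _ hf); rewrite (fD o2 o3) ?orbT // /pair_rel !eqxx.
(* If the outer neighbours coincide in [o], its neighbours are exactly the triangle and all its
   labels are 0, against [has1]. *)
subst o2 o3; rename o1 into o.
have [|z ez pz] := @has1 o x1; first by rewrite e_sym.
have No u : e o u = [|| u == x1, u == x2 | u == x3].
  have oC : o \in C by move: oC1; rewrite inE => /andP[].
  have eo1 : e o x1 by rewrite e_sym.
  have eo2 : e o x2 by rewrite e_sym.
  have [a [_ _ N]] := third_nbr (cubic oC) eo1 eo2 n12.
  have := N x3; rewrite (e_sym o x3) e3 (negPf n31) (eq_sym x3 x2) (negPf n23) /= N.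
  by move/esym/eqP->.
move: ez pz; rewrite No => /or3P[] /eqP->; rewrite p_sym ?(negPf q1) //.
  by rewrite (negPf q2).
by rewrite (negPf q3).
Qed.

(** * 4-cycle cores in a triangle-free component *)

Hypothesis no_triangle : forall x y z, x \in C -> e x y -> e y z -> ~~ e z x.

(** By [close4], a boundary can be bad only if all outer labels are 0 and both pairs of opposite
    corners see equal vectors. The last premise gives an outer label 1 or a pair for [D] to
    separate. *)
Lemma solvable_cycle4_outer c1 c2 c3 c4 o1 o2 o3 o4 :
    c1 \in C -> e c1 c2 -> e c2 c3 -> e c3 c4 -> e c4 c1 -> c1 != c3 -> c2 != c4 ->
    p c1 c2 ->
    (forall u, e c1 u = [|| u == c4, u == c2 | u == o1]) ->
    (forall u, e c2 u = [|| u == c1, u == c3 | u == o2]) ->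
    (forall u, e c3 u = [|| u == c2, u == c4 | u == o3]) ->
    (forall u, e c4 u = [|| u == c3, u == c1 | u == o4]) ->
    o1 != c2 -> o1 != c4 -> o2 != c1 -> o2 != c3 ->
    o3 != c2 -> o3 != c4 -> o4 != c1 -> o4 != c3 ->
    [|| p c1 o1, p c2 o2, p c3 o3, p c4 o4, o1 != o3 | o2 != o4] ->
  solvable.
Proof.
move=> c1C e12 e23 e34 e41 n13 n24 p12 N1 N2 N3 N4 o12 o14 o21 o23 o32 o34 o41 o43.
have n12 := edge_neq e12; have n23 := edge_neq e23.
have n34 := edge_neq e34; have n41 := edge_neq e41.
have c2C := C_closed c1C e12; have c3C := C_closed c2C e23.
have c4C := C_closed c3C e34.
have e1 : e c1 o1 by rewrite N1 eqxx !orbT.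
have e2 : e c2 o2 by rewrite N2 eqxx !orbT.
have e3 : e c3 o3 by rewrite N3 eqxx !orbT.
have e4 : e c4 o4 by rewrite N4 eqxx !orbT.
have n1 := edge_neq e1; have n2 := edge_neq e2.
have n3 := edge_neq e3; have n4 := edge_neq e4.
(* A chord would create a triangle, so the outer neighbours lie off the cycle. *)
have o13 : o1 != c3.
  by apply: contraNneq (no_triangle c1C e12 e23) => <-; rewrite e_sym.
have o24 : o2 != c4.
  by apply: contraNneq (no_triangle c2C e23 e34) => <-; rewrite e_sym.
have o31 : o3 != c1.
  by apply: contraNneq (no_triangle c3C e34 e41) => <-; rewrite e_sym.
have o42 : o4 != c2.
  by apply: contraNneq (no_triangle c4C e41 e12) => <-; rewrite e_sym.
pose S := [set c1; c2; c3; c4].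
have SE u : (u \in S) = [|| u == c1, u == c2, u == c3 | u == c4].
  by rewrite !inE -!orbA.
have SC : S \subset C.
  by apply/subsetP=> u; rewrite SE => /or4P[] /eqP->.
have S0 : S != set0 by apply/set0Pn; exists c1; rewrite SE eqxx.
have bS s : s \in S :\: S -> #|[set y | e s y] :\: S| <= 2 by rewrite setDv inE.
have S1 : c1 \in S by rewrite SE eqxx.
have S2 : c2 \in S by rewrite SE eqxx orbT.
have S3 : c3 \in S by rewrite SE eqxx !orbT.
have S4 : c4 \in S by rewrite SE eqxx !orbT.
have oS i o : i \in C -> e i o -> o != c1 -> o != c2 -> o != c3 -> o != c4 ->
    o \in C :\: S.
  move=> iC ei m1 m2 m3 m4; rewrite in_setD SE (C_closed iC ei).
  by rewrite (negPf m1) (negPf m2) (negPf m3) (negPf m4).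
have O1 : o1 \in C :\: S by apply: (oS c1) => //; rewrite eq_sym.
have O2 : o2 \in C :\: S by apply: (oS c2) => //; rewrite eq_sym.
have O3 : o3 \in C :\: S by apply: (oS c3) => //; rewrite eq_sym.
have O4 : o4 \in C :\: S by apply: (oS c4) => //; rewrite eq_sym.
have fin f D : partial e p C S D pred0 S f ->
    [|| p c1 o1, p c2 o2, p c3 o3, p c4 o4, f o1 != f o3 | f o2 != f o4] -> solvable.
  move=> hf cond; have [f0 _ _ _ _] := hf.
  have [y1 [y2 [y3 [y4 [[h1 h2 h3 h4] [h12 h23 h34 h41]]]]]] :
      exists y1 y2 y3 y4, [/\ dot y1 (f o1) = p c1 o1, dot y2 (f o2) = p c2 o2,
        dot y3 (f o3) = p c3 o3 & dot y4 (f o4) = p c4 o4] /\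
      [/\ dot y1 y2, dot y2 y3 = p c2 c3, dot y3 y4 = p c3 c4
        & dot y4 y1 = p c4 c1].
    apply: close4 cond; try exact: f0.
      by have := has1_3 N3; rewrite (p_sym c3 c2).
    by have := has1_3 N4; rewrite (p_sym c4 c3).
  pose f' u := if u == c1 then y1 else if u == c2 then y2 else
    if u == c3 then y3 else if u == c4 then y4 else f u.
  have F1 : f' c1 = y1 by rewrite /f' eqxx.
  have F2 : f' c2 = y2 by rewrite /f' (eq_sym c2 c1) (negPf n12) eqxx.
  have F3 : f' c3 = y3.
    by rewrite /f' (eq_sym c3 c1) (negPf n13) (eq_sym c3 c2) (negPf n23) eqxx.
  have F4 : f' c4 = y4.
    rewrite /f' (negPf n41) (eq_sym c4 c2) (negPf n24) (eq_sym c4 c3).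
    by rewrite (negPf n34) eqxx.
  have F u : u \notin S -> f' u = f u.
    by rewrite SE /f' !negb_or => /and4P[/negPf-> /negPf-> /negPf-> /negPf->].
  have G o : o \in C :\: S -> f' o = f o by move=> /setDP[_]; apply: F.
  have P12 : dot y1 y2 = p c1 c2 by rewrite p12.
  apply: (extend (f' := f') hf) => [u|u z]; first exact: F.
  rewrite SE => /or4P[] /eqP->.
  - by rewrite N1 => /or3P[] /eqP->; rewrite F1 ?F2 ?F4 ?(G o1) // dotC p_sym.
  - by rewrite N2 => /or3P[] /eqP->; rewrite F2 ?F1 ?F3 ?(G o2) // dotC p_sym.
  - by rewrite N3 => /or3P[] /eqP->; rewrite F3 ?F2 ?F4 ?(G o3) // dotC p_sym.
  - by rewrite N4 => /or3P[] /eqP->; rewrite F4 ?F1 ?F3 ?(G o4) // dotC p_sym.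
have pairS a b (ab : a != b) : (exists2 i, i \in S & e a i && ~~ p a i) ->
    (exists2 i, i \in S & e b i && ~~ p b i) ->
    exists f, partial e p C S (pair_rel a b) pred0 S f.
  move=> ha hb; apply: (greedy e_sym e_irr p_sym deg3 has1 C_closed C_conn SC S0
    (subxx S) bS (pair_rel_sym a b) (pair_rel_irr ab)) => //.
    by move=> x y z; apply: pair_rel_uniq.
  by move=> x y /orP[] /andP[/eqP-> _].
have [q _|] := boolP [|| p c1 o1, p c2 o2, p c3 o3 | p c4 o4].
  pose noD : rel V := fun _ _ => false.
  have [//|f hf] := greedy e_sym e_irr p_sym deg3 has1 C_closed C_conn SC S0
    (subxx S) bS (D := noD) (E := pred0) (fun _ _ => erefl) (fun _ => erefl)
    (fun _ _ _ h => match notF h with end) (fun _ _ _ => isT)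
    (fun _ _ h => match notF h with end).
  by apply: (fin f noD hf); case/or4P: q => ->; rewrite ?orbT.
rewrite !negb_or => /and4P[q1 q2 q3 q4].
rewrite (negPf q1) (negPf q2) (negPf q3) (negPf q4) /=.
have w i o : i \in S -> e i o -> ~~ p i o -> exists2 i, i \in S & e o i && ~~ p o i.
  by move=> iS ei qi; exists i; rewrite // e_sym ei p_sym.
case/orP=> d.
  have [f hf] := pairS _ _ d (w _ _ S1 e1 q1) (w _ _ S3 e3 q3).
  by have [_ _ _ fD _] := hf; apply: (fin f _ hf); rewrite (fD o1 o3) ?orbT // /pair_rel !eqxx.
have [f hf] := pairS _ _ d (w _ _ S2 e2 q2) (w _ _ S4 e4 q4).
by have [_ _ _ fD _] := hf; apply: (fin f _ hf); rewrite (fD o2 o4) ?orbT // /pair_rel !eqxx.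
Qed.

Lemma solvable_cycle4 c1 c2 c3 c4 :
  c1 \in C -> e c1 c2 -> e c2 c3 -> e c3 c4 -> e c4 c1 -> c1 != c3 -> c2 != c4 ->
  p c1 c2 -> solvable.
Proof.
move=> c1C e12 e23 e34 e41 n13 n24 p12.
have c2C := C_closed c1C e12; have c3C := C_closed c2C e23.
have c4C := C_closed c3C e34.
have e21 : e c2 c1 by rewrite e_sym.
have e32 : e c3 c2 by rewrite e_sym.
have e43 : e c4 c3 by rewrite e_sym.
have e14 : e c1 c4 by rewrite e_sym.
have [|o1 [o14 o12 N1]] := third_nbr (cubic c1C) e14 e12; first by rewrite eq_sym.
have [|o2 [o21 o23 N2]] := third_nbr (cubic c2C) e21 e23; first by [].
have [|o3 [o32 o34 N3]] := third_nbr (cubic c3C) e32 e34; first by [].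
have [|o4 [o43 o41 N4]] := third_nbr (cubic c4C) e43 e41; first by rewrite eq_sym.
have [q|] := boolP [|| p c1 o1, p c2 o2, p c3 o3, p c4 o4, o1 != o3 | o2 != o4].
  exact: (solvable_cycle4_outer c1C e12 e23 e34 e41 n13 n24 p12 N1 N2 N3 N4).
rewrite !negb_or !negbK => /and5P[q1 q2 q3 q4 /andP[/eqP o13 /eqP o24]].
subst o3 o4; have e1o : e c1 o1 by rewrite N1 eqxx !orbT.
have e3o : e c3 o1 by rewrite N3 eqxx !orbT.
have eo1 : e o1 c1 by rewrite e_sym.
have eo3 : e o1 c3 by rewrite e_sym.
have o1C := C_closed c1C e1o.
have [|x [x3 x1 No]] := third_nbr (cubic o1C) eo3 eo1; first by rewrite eq_sym.
have px : p o1 x.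
  have := has1_3 No; rewrite (p_sym o1 c3) (negPf q3) (p_sym o1 c1) (negPf q1).
  by [].
(* Replacing [c4] by its twin [o1] gives another 4-cycle through [c1 c2], now with the outer edge
   [o1 x] labelled 1. *)
apply: (@solvable_cycle4_outer c1 c2 c3 o1 c4 o2 c4 x) => //.
- by rewrite eq_sym.
- by move=> u; rewrite N1; case: (u == c4); case: (u == c2); case: (u == o1).
- by move=> u; rewrite N3; case: (u == c4); case: (u == c2); case: (u == o1).
- by rewrite eq_sym.
- by rewrite eq_sym.
- by rewrite eq_sym.
- by rewrite eq_sym.
- by rewrite px !orbT.
Qed.

(** * Cores around an edge labelled 1 *)

Hypothesis no_cycle4 : forall c1 c2 c3 c4, c1 \in C -> e c1 c2 -> e c2 c3 ->
  e c3 c4 -> e c4 c1 -> c1 != c3 -> c2 != c4 -> ~~ p c1 c2.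

Definition edge_core (v w : V) : {set V} :=
  [set u | [|| u == v, u == w, e v u && ~~ p v u | e w u && ~~ p w u]].

Lemma edge_coreC v w : edge_core v w = edge_core w v.
Proof.
apply/setP=> u; rewrite !inE.
by case: (u == v); case: (u == w) => //=; rewrite orbC.
Qed.

(* The condition that the neighbour [x] puts on the vector [u] of [v] follows
   from the single linear equation [u . h = 1], as if [x] were coloured by [h]
   and [vx] labelled 1: if [x] can take two values [s] and [s'], then
   [h := s + s'] works. *)
Lemma edge_side v w x D E f :
    v \in C -> e v w -> p v w -> e v x -> x != w ->
    partial e p C [set v; w] D E (edge_core v w) f ->
  exists2 h, h != vec0 & forall u, dot u h -> exists s,
    [/\ dot u s = p v x, x \notin edge_core v w -> s = f x &
      x \in edge_core v w -> forall y, e x y -> y != v ->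
        y \notin edge_core v w /\ dot s (f y) = p x y].
Proof.
move=> vC evw pvw evx xw [f0 _ f3 _ _]; have xC := C_closed vC evx.
have xv : x != v by rewrite eq_sym edge_neq.
have nwx : ~~ e w x by have := no_triangle xC _ evw; rewrite (e_sym x v); apply.
have xK : (x \in edge_core v w) = ~~ p v x.
  by rewrite inE (negPf xv) (negPf xw) (negPf nwx) evx /= orbF.
have [pvx|pvx] := boolP (p v x).
  exists (f x); first by apply: f0; rewrite inE xK pvx.
  by move=> u ux; exists (f x); split=> //; rewrite ?xK ?pvx.
have exv : e x v by rewrite e_sym.
have [y1 [y2 [y1v y2v y12 Nx]]] := other_nbrs (cubic xC) exv.
(* Without triangles, [y] is neither [w] nor adjacent to [v]; an edge [w y] would put [v w],
   labelled 1, on the 4-cycle [v w y x]. *)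
have out y : e x y -> y != v -> y \in C :\: edge_core v w.
  move=> exy yv; rewrite in_setD (C_closed xC exy) andbT inE (negPf yv) /=.
  have yw : y != w by apply: contraNneq nwx => <-; rewrite e_sym.
  have nvy : ~~ e v y by rewrite e_sym; apply: no_triangle evx exy.
  rewrite (negPf yw) (negPf nvy) /=; apply: contraL pvw => /andP[ewy _].
  by apply: (no_cycle4 vC evw ewy) exv _ _; rewrite 1?eq_sym // e_sym.
have ex1 : e x y1 by rewrite Nx eqxx orbT.
have ex2 : e x y2 by rewrite Nx eqxx !orbT.
have [||||h h0 hh] := @pivot (f y1) (f y2) (p x y1) (p x y2).
- exact/f0/out.
- exact/f0/out.
- by have := has1_3 Nx; rewrite p_sym (negPf pvx).
- by apply: (f3 x); rewrite ?out // !inE (negPf xv) (negPf xw) evx pvx.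
exists h => // u /hh[s [s1 s2 us]]; exists s; rewrite xK pvx.
split=> // _ y exy yv.
split; first by have := out _ exy yv => /setDP[].
by move: exy; rewrite Nx (negPf yv) /= => /orP[] /eqP->.
Qed.

(** [edge_side] turns the conditions at the four other neighbours into linear equations,
    [close_edge] solves them for [v] and [w], and only then do the neighbours in the core get their
    vectors. *)
Lemma solvable_edge v w : v \in C -> e v w -> p v w -> solvable.
Proof.
move=> vC evw pvw; have wC := C_closed vC evw; have nvw := edge_neq evw.
have ewv : e w v by rewrite e_sym.
have pwv : p w v by rewrite p_sym.
pose K := edge_core v w.
have KE : K = edge_core w v by apply: edge_coreC.
have vK : v \in K by rewrite inE eqxx.
have wK : w \in K by rewrite inE eqxx orbT.
have KC : K \subset C.
  apply/subsetP=> u; rewrite inE => /or4P[/eqP->|/eqP->|/andP[eu _]|/andP[eu _]] //.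
    exact: C_closed eu.
  exact: C_closed eu.
have K0 : K != set0 by apply/set0Pn; exists v.
have FK : [set v; w] \subset K by rewrite subUset !sub1set vK wK.
have bK s : s \in K :\: [set v; w] -> #|[set y | e s y] :\: K| <= 2.
  move=> sK; have [i iK esi] : exists2 i, i \in K & e s i.
    move: sK; rewrite !inE negb_or -andbA => /and3P[/negPf-> /negPf-> /=].
    by case/orP=> /andP[es _]; [exists v | exists w]; rewrite // e_sym.
  rewrite -ltnS; apply: leq_trans (deg3 s).
  rewrite [leqRHS](cardsD1 i) inE esi ltnS subset_leq_card //.
  apply/subsetP=> y; rewrite !inE => /andP[yK ->]; rewrite andbT.
  by apply: contraNneq yK => ->; move: iK; rewrite inE.
pose noD : rel V := fun _ _ => false.
have [//|f hf] := greedy e_sym e_irr p_sym deg3 has1 C_closed C_conn KC K0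
  FK bK (D := noD) (E := pred0) (fun _ _ => erefl) (fun _ => erefl)
  (fun _ _ _ h => match notF h with end) (fun _ _ _ => isT)
  (fun _ _ h => match notF h with end).
have hf' : partial e p C [set w; v] noD pred0 (edge_core w v) f.
  by rewrite setUC -KE.
have [a [b [aw bw ab Nv]]] := other_nbrs (cubic vC) evw.
have [c [d [cv dv cd Nw]]] := other_nbrs (cubic wC) ewv.
have eva : e v a by rewrite Nv eqxx orbT.
have evb : e v b by rewrite Nv eqxx !orbT.
have ewc : e w c by rewrite Nw eqxx orbT.
have ewd : e w d by rewrite Nw eqxx !orbT.
have av : a != v by rewrite eq_sym edge_neq.
have bv : b != v by rewrite eq_sym edge_neq.
have cw : c != w by rewrite eq_sym edge_neq.
have dw : d != w by rewrite eq_sym edge_neq.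
have disj x y : e v x -> e w y -> x != y.
  move=> evx ewy; apply: contraTneq evx => ->; rewrite e_sym.
  exact: no_triangle vC evw ewy.
have ac := disj _ _ eva ewc; have ad := disj _ _ eva ewd.
have bc := disj _ _ evb ewc; have bd := disj _ _ evb ewd.
have [ha a0 Ha] := edge_side vC evw pvw eva aw hf.
have [hb b0 Hb] := edge_side vC evw pvw evb bw hf.
have [hc c0 Hc] := edge_side wC ewv pwv ewc cv hf'.
have [hd d0 Hd] := edge_side wC ewv pwv ewd dv hf'.
have [yv [yw [/Ha[sa [Sa Oa Ia]] /Hb[sb [Sb Ob Ib]] /Hc[sc [Sc Oc Ic]]
  /Hd[sd [Sd Od Id]] yvw]]] := close_edge a0 b0 c0 d0.
rewrite -!KE -/K in Oa Ia Ob Ib Oc Ic Od Id.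
pose f' u := if u == v then yv else if u == w then yw else if u == a then sa
  else if u == b then sb else if u == c then sc else if u == d then sd else f u.
have Fv : f' v = yv by rewrite /f' eqxx.
have Fw : f' w = yw by rewrite /f' eq_sym (negPf nvw) eqxx.
have Fa : f' a = sa by rewrite /f' (negPf av) (negPf aw) eqxx.
have Fb : f' b = sb by rewrite /f' (negPf bv) (negPf bw) (eq_sym b a) (negPf ab) eqxx.
have Fc : f' c = sc.
  by rewrite /f' (negPf cv) (negPf cw) !(eq_sym c) (negPf ac) (negPf bc) eqxx.
have Fd : f' d = sd.
  by rewrite /f' (negPf dv) (negPf dw) !(eq_sym d) (negPf ad) (negPf bd) (negPf cd) eqxx.
(* Those of [a], [b], [c], [d] outside [K] are overwritten with their own value under [f]. *)
have F u : u \notin K -> f' u = f u.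
  move=> uK; rewrite /f'; case: eqP uK => [->|_]; first by rewrite vK.
  case: eqP => [->|_ uK]; first by rewrite wK.
  case: eqP uK => [-> /Oa //|_]; case: eqP => [-> /Ob //|_].
  by case: eqP => [-> /Oc //|_]; case: eqP => [-> /Od //|_].
apply: (extend (f' := f') hf) => [u|x y]; first exact: F.
have sideP i x0 y0 s : f' i = y0 -> f' x0 = s -> dot y0 s = p i x0 ->
    (forall z, e x0 z -> z != i -> z \notin K /\ dot s (f z) = p x0 z) ->
    forall z, e x0 z -> dot (f' x0) (f' z) = p x0 z.
  move=> Fi Fx dis out z exz; have [->|zi] := eqVneq z i.
    by rewrite Fi Fx dotC dis p_sym.
  by have [zK <-] := out z exz zi; rewrite Fx F.
move=> xK; move: (xK); rewrite inE => /or4P[/eqP->|/eqP->||].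
- by rewrite Nv => /or3P[] /eqP->; rewrite Fv ?Fw ?Fa ?Fb ?pvw.
- by rewrite Nw => /or3P[] /eqP->; rewrite Fw ?Fv ?Fc ?Fd // dotC pwv.
- case/andP; rewrite Nv => /or3P[] /eqP xE; rewrite xE ?pvw // in xK *.
    by move=> _; apply: (sideP v a yv sa) => //; apply: Ia.
  by move=> _; apply: (sideP v b yv sb) => //; apply: Ib.
case/andP; rewrite Nw => /or3P[] /eqP xE; rewrite xE ?pwv // in xK *.
  by move=> _; apply: (sideP w c yw sc) => //; apply: Ic.
by move=> _; apply: (sideP w d yw sd) => //; apply: Id.
Qed.

End Component.

(** * From components to inversions *)

Section Labelling.

Variables (V : finType) (e : rel V).
Hypotheses (e_sym : symmetric e) (e_irr : irreflexive e).
Hypothesis deg3 : forall x, #|[set y | e x y]| <= 3.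

(** Each core that does not occur supplies a hypothesis for the next case; in the end [has1] yields
    an edge labelled 1 at [r]. *)
Lemma solvable_component (p : V -> V -> bool) (r : V) :
    (forall x y, p x y = p y x) ->
    (forall x y, e x y -> exists2 z, e x z & p x z) ->
  solvable e p [set y | connect e r y].
Proof.
move=> p_sym has1; set C := [set y | _].
have c_sym : connect_sym e by apply: sym_connect_sym.
have C_closed x y : x \in C -> e x y -> y \in C.
  by rewrite !inE => rx exy; apply: connect_trans rx (connect1 exy).
have C_conn (R : {set V}) : R \subset C -> R != set0 -> R != C ->
    exists s t, [/\ s \in R, t \in C :\: R & e s t].
  move=> RC /set0Pn[x xR]; rewrite eqEsubset RC /= => /subsetPn[z zC zR].
  have [/existsP[s /existsP[t /and3P[sR tR est]]]|clo] :=
    boolP [exists s, exists t, [&& s \in R, t \notin R & e s t]].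
    by exists s, t; rewrite inE tR (C_closed s) // (subsetP RC).
  have clR : closed e R.
    apply: (intro_closed c_sym) => s t est sR; apply: contraNT clo => tR.
    by apply/existsP; exists s; apply/existsP; exists t; rewrite sR tR.
  have xz : connect e x z.
    move: (subsetP RC x xR) zC; rewrite !inE c_sym; exact: connect_trans.
  by rewrite -(closed_connect clR xz) xR in zR.
have [/exists_inP[x xC d]|/exists_inPn d3] :=
  boolP [exists x in C, #|[set y | e x y]| <= 2].
  exact: (solvable_deg2 e_sym e_irr p_sym deg3 has1 C_closed C_conn xC).
have cubic : {in C, forall x, #|[set y | e x y]| = 3}.
  by move=> x xC; apply/eqP; rewrite eqn_leq deg3 ltnNge d3.
have rC : r \in C by rewrite inE.
have [/exists_inP[x xC /existsP[y /existsP[z /and3P[exy eyz ezx]]]]|tri] := boolP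
    [exists x in C, exists y, exists z, [&& e x y, e y z & e z x]].
  exact: (solvable_triangle e_sym e_irr p_sym deg3 has1 C_closed C_conn cubic
    xC exy eyz ezx).
have no_triangle x y z : x \in C -> e x y -> e y z -> ~~ e z x.
  move=> xC exy eyz; apply: contra tri => ezx; apply/exists_inP; exists x => //.
  by apply/existsP; exists y; apply/existsP; exists z; rewrite exy eyz.
have [|cyc] := boolP [exists x in C, exists y, exists z, exists t,
    [&& e x y, e y z, e z t & e t x] && [&& x != z, y != t & p x y]].
  case/exists_inP=> x xC /existsP[y /existsP[z /existsP[t]]].
  case/andP=> /and4P[exy eyz ezt etx] /and3P[xz yt pxy].
  exact: (solvable_cycle4 e_sym e_irr p_sym deg3 has1 C_closed C_conn cubic
    no_triangle xC exy eyz ezt etx).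
have no_cycle4 x y z t : x \in C -> e x y -> e y z -> e z t -> e t x ->
    x != z -> y != t -> ~~ p x y.
  move=> xC exy eyz ezt etx xz yt; apply: contra cyc => pxy.
  apply/exists_inP; exists x => //; apply/existsP; exists y; apply/existsP.
  by exists z; apply/existsP; exists t; rewrite exy eyz ezt etx xz yt.
have /card_gt0P[y] : 0 < #|[set y | e r y]| by rewrite cubic.
rewrite inE => /has1[z erz prz].
exact: (solvable_edge e_sym e_irr p_sym deg3 has1 C_closed C_conn cubic
  no_triangle no_cycle4 rC erz prz).
Qed.

Theorem labelling (p : V -> V -> bool) : (forall x y, p x y = p y x) ->
  exists f : V -> vec, forall x y, e x y -> dot (f x) (f y) = p x y.
Proof.
move=> p_sym; pose T x := ~~ [exists y, e x y && p x y].
(* Vertices in [T] end up with [vec0], so labels at them may be raised to 1, which yields [has1]. *)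
pose q x y := [|| T x, T y | p x y].
have q_sym x y : q x y = q y x by rewrite /q p_sym orbCA.
have has1 x y : e x y -> exists2 z, e x z & q x z.
  move=> exy; have [Tx|] := boolP (T x); first by exists y; rewrite // /q Tx.
  by rewrite negbK => /existsP[z /andP[exz pxz]]; exists z; rewrite // /q pxz !orbT.
have /fin_all_exists[g hg] r := solvable_component r q_sym has1.
(* Solutions are glued along components, each indexed by its root. *)
pose rt := root e; exists (fun x => if T x then vec0 else g (rt x) x) => x y exy.
have Tp u z : e u z -> T u -> p u z = false.
  move=> euz; apply: contraNF => puz; apply/existsP; exists z.
  by rewrite euz puz.
have [Tx|nTx] := boolP (T x); first by rewrite (Tp x y).
have [Ty|nTy] := boolP (T y); first by rewrite dotC p_sym (Tp y x) // e_sym.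
have c_sym : connect_sym e by apply: sym_connect_sym.
have rxy : rt x = rt y by apply/eqP; rewrite root_connect // connect1.
have rx : connect e (rt x) x by rewrite c_sym connect_root.
rewrite -rxy hg ?inE //; first by rewrite /q (negPf nTx) (negPf nTy).
exact: connect_trans rx (connect1 exy).
Qed.

End Labelling.

(** * From vectors to three inversions *)

Section Orientations.

Variables (V : finType) (G : sgraph V).

Lemma in_orientation (A : orientation G) x y :
  ((y, x) \in arcs A) = G x y && ((x, y) \notin arcs A).
Proof.
have := forallP (forallP (arcsP A) y) x; rewrite (adj_sym G y x).
by case: (G x y) => [|/negPf //]; case: (_ \in _); case: (_ \in _).
Qed.

Lemma in_invert (X : {set V}) (A : orientation G) x y : G x y ->
  ((x, y) \in arcs (invert X A)) =
    ((x \in X) && (y \in X)) (+) ((x, y) \in arcs A).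
Proof. by move=> Gxy; rewrite inE /= in_orientation Gxy; case: ifP. Qed.

(** The walk is empty when the inversion fixes [A], since the inversion graph has no loops. *)
Lemma invert_walk (X : {set V}) (A : orientation G) :
  exists2 s, size s <= 1 & path (inversion_graph G) A s /\ last A s = invert X A.
Proof.
have [AX|AX] := eqVneq A (invert X A); first by exists [::].
exists [:: invert X A] => //=; split=> //; rewrite andbT.
by apply/andP; split=> //; apply/existsP; exists X.
Qed.

(** The three sets are the supports of the coordinates of [f]. The edge [x y] is reversed once per
    coordinate equal to 1 at both ends, so the parity is [dot (f x) (f y)]. *)
Lemma three_inversions (A B : orientation G) :
    (forall x, #|[set y | G x y]| <= 3) ->
  exists X Y Z, invert X (invert Y (invert Z A)) = B.
Proof.
move=> deg3; pose p x y := ((x, y) \in arcs A) (+) ((x, y) \in arcs B).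
have p_sym x y : p x y = p y x.
  rewrite /p !(in_orientation _ y x) !(in_orientation _ x y) (adj_sym G y x).
  by case: (G x y) => //=; rewrite !negbK addbN addNb negbK.
have [f hf] := labelling (adj_sym G) (adj_irrefl G) deg3 p_sym.
exists [set x | (f x).1.1], [set x | (f x).1.2], [set x | (f x).2].
apply/val_inj/setP=> -[x y]; rewrite -![val _]/(arcs _).
have [Gxy|nGxy] := boolP (G x y); last first.
  by rewrite !(in_orientation _ y x) (adj_sym G) (negPf nGxy).
rewrite !in_invert // !inE !addbA; move: (hf x y Gxy); rewrite /dot /p => ->.
by rewrite addbAC addbb.
Qed.

End Orientations.

Lemma dist_le (V : finType) (G : sgraph V) (k : nat) (x y : V) :
  has_walk G k x y -> exists2 d, dist G x y = Some d & d <= k.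
Proof.
move=> w; have [d wd dmin] := ex_minnP (ex_intro (fun k => has_walk G k x y) k w).
by exists d; [apply/distP | apply: dmin].
Qed.

Theorem theorem1p4 (V : finType) (G : sgraph V) (hG : max_degree G = 3) :
  exists2 d, diam (inversion_graph G) = Some d & d <= 3.
Proof.
have deg3 x : #|[set y | G x y]| <= 3.
  by rewrite -hG; apply: (leq_bigmax (F := degree G)).
have dist3 (A B : orientation G) :
    exists2 d, dist (inversion_graph G) A B = Some d & d <= 3.
  have [X [Y [Z <-]]] := three_inversions A B deg3.
  have [s1 n1 [p1 l1]] := invert_walk Z A.
  have [s2 n2 [p2 l2]] := invert_walk Y (invert Z A).
  have [s3 n3 [p3 l3]] := invert_walk X (invert Y (invert Z A)).
  have [] := @dist_le _ (inversion_graph G) (size (s1 ++ s2 ++ s3)) A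
    (invert X (invert Y (invert Z A))).
    apply/has_walkP; exists (s1 ++ s2 ++ s3); rewrite !cat_path !last_cat.
    by rewrite l1 l2 l3 p1 p2 p3.
  move=> d dE dle; exists d => //; apply: leq_trans dle _.
  by rewrite !size_cat (leq_add n1 (leq_add n2 n3)).
rewrite /diam ifT; last first.
  by apply/forallP=> A; apply/forallP=> B; have [d ->] := dist3 A B.
eexists; first by [].
apply/bigmax_leqP=> A _; apply/bigmax_leqP=> B _.
by have [d ->] := dist3 A B.
Qed.
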